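(* Let $(A,\succ,\prec)$ be a pre-APL algebra and $(A,\circ)$ its sub-adjacent anti-pre-Lie algebra. Let $\{e_1,\dots,e_n\}$ be a basis of $A$ and $\{e_1^*,\dots,e_n^*\}$ the dual basis. Then $$r=\sum_{i=1}^n(e_i\otimes e_i^*-e_i^*\otimes e_i)$$ is a skew-symmetric solution of the APL-YBE in the semi-direct product anti-pre-Lie algebra $A\ltimes_{\mathcal R_\prec^*-\mathcal L_\succ^*,\,\mathcal R_\prec^*}A^*$.
   Context: All vector spaces and algebras are finite-dimensional over an algebraically closed field $\mathbb K$ of characteristic zero. Anti-pre-Lie algebra: a vector space $A$ with a bilinear operation $\circ$ such that, with $[x,y]=x\circ y-y\circ x$, for all $x,y,z$: $x\circ(y\circ z)-y\circ(x\circ z)=[y,x]\circ z$ and $[x,y]\circ z+[y,z]\circ x+[z,x]\circ y=0$. Pre-APL (pre-anti-pre-Lie) algebra $(A,\succ,\prec)$: bilinear operations on $A$ such that for all $x,y,z$: $(y\succ x+y\prec x)\succ z-(x\succ y+x\prec y)\succ z=x\succ(y\succ z)-y\succ(x\succ z)$; $z\prec(x\succ y+x\prec y)=x\succ(z\prec y)+(x\succ z)\prec y-(z\prec x)\prec y$; $(y\succ x+y\prec x)\succ z-(x\succ y+x\prec y)\succ z=(y\succ z)\prec x-(x\succ z)\prec y-(z\prec y)\prec x+(z\prec x)\prec y$. Its sub-adjacent anti-pre-Lie algebra is $(A,\circ)$ with $x\circ y=x\succ y+x\prec y$. Put $\mathcal L_\succ(x)y=x\succ y$, $\mathcal R_\prec(x)y=y\prec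 x$; $(\mathcal L_\succ,\mathcal R_\prec,A)$ is a representation of $(A,\circ)$. Representation $(l,r,V)$ of $(A,\circ)$: linear maps $l,r:A\to\mathrm{End}(V)$ with $l(y\circ x)-l(x\circ y)=l(x)l(y)-l(y)l(x)$; $r(x\circ y)=l(x)r(y)+r(y)l(x)-r(y)r(x)$; $l(y\circ x)-l(x\circ y)=r(x)l(y)-r(y)l(x)-r(x)r(y)+r(y)r(x)$. The semi-direct product $A\ltimes_{l,r}V$ is the anti-pre-Lie algebra $A\oplus V$ with $(x+u)\circ(y+v)=x\circ y+l(x)v+r(y)u$. For linear $\rho:A\to\mathrm{End}(V)$, $\langle\rho^*(x)u^*,v\rangle=-\langle u^*,\rho(x)v\rangle$. If $(l,r,V)$ is a representation then so is $(r^*-l^*,r^*,V^* )$. APL-YBE in an anti-pre-Lie algebra: $r=\sum_i a_i\otimes b_i$ is a solution if $\sum_{i,j}\big(a_i\circ a_j\otimes b_i\otimes b_j+a_i\otimes b_i\circ a_j\otimes b_j-a_i\otimes a_j\otimes[b_i,b_j]\big)=0$; $r$ is skew-symmetric if $\tau(r)=-r$, where $\tau(x\otimes y)=y\otimes x$. *)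

(* Defs.v *)
From HB Require Import structures.
From mathcomp Require Import all_boot all_order all_algebra.
From mathcomp Require Import ring.

Set Implicit Arguments.
Unset Strict Implicit.
Unset Printing Implicit Defensive.

Import GRing.Theory.
Local Open Scope ring_scope.

Fact scalar_inj (K : fieldType) (V : vectType K) (x y : V) :
  (forall f : {scalar V}, f x = f y) -> x = y.
Proof.
move=> xy; rewrite (coord_vbasis (memvf x)) (coord_vbasis (memvf y)).
by apply: eq_bigr => i _; congr (_ *: _); apply: xy.
Qed.

(* Proves an identity between +/- combinations of vectors.                    *)
Ltac abgroup :=
  first [apply: scalar_inj | apply: (@scalar_inj _ _^o)]; let f := fresh "f" in
  intro f; rewrite !(linearD f, linearN f, linear0 f); ring.

Fact lincomb (V : zmodType) (a b l r : V) : a = b -> l - r = a - b -> l = r.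
Proof. by move=> -> /eqP; rewrite subrr subr_eq0 => /eqP. Qed.

Fact addE (V : zmodType) (a b c d : V) : a = b -> c = d -> a + c = b + d.
Proof. by move=> -> ->. Qed.

Fact subE (V : zmodType) (a b c d : V) : a = b -> c = d -> a - c = b - d.
Proof. by move=> -> ->. Qed.

Section Dual.
Variables (K : fieldType) (V : vectType K).

Definition dual : vectType K := 'Hom(V, K^o).

Definition dual_basis n (e : n.-tuple V) (i : 'I_n) : dual :=
  linfun (coord e i : V -> K^o).

Lemma dual_basisE n (e : n.-tuple V) (i : 'I_n) (x : V) :
  dual_basis e i x = coord e i x.
Proof. by rewrite /dual_basis lfunE. Qed.

Lemma dual_basis_delta n (e : n.-tuple V) (i j : 'I_n) :
  basis_of fullv e -> dual_basis e i e`_j = (i == j)%:R.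
Proof. by move=> /basis_free fe; rewrite dual_basisE coord_free // eq_sym. Qed.

End Dual.

Section Tensor.
Variable K : fieldType.
Implicit Types U V W : vectType K.

(* For finite-dimensional spaces V (x) W is Hom(V^*, W), the pure tensor      *)
(* x (x) y being f |-> f(x) y; tens_liftE and tens_lift_uniq below are the    *)
(* universal property.                                                        *)
Definition tensor V W : vectType K := 'Hom(dual V, W).

Definition tens_fun V W (x : V) (y : W) (f : dual V) : W := (f x : K) *: y.

Fact tens_fun_linear V W (x : V) (y : W) : linear (tens_fun x y).
Proof.
move=> a f g; rewrite /tens_fun add_lfunE scale_lfunE.
by rewrite scalerDl /= -scalerA.
Qed.
HB.instance Definition _ V W (x : V) (y : W) :=
  GRing.isLinear.Build _ _ _ _ _ (tens_fun_linear x y).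

Definition tens V W (x : V) (y : W) : tensor V W := linfun (tens_fun x y).

Lemma tensE V W (x : V) (y : W) (f : dual V) : tens x y f = (f x : K) *: y.
Proof. by rewrite lfunE. Qed.

Fact tens_bilinear V W : bilinear_for *:%R *:%R (@tens V W).
Proof.
split=> [y|x] a u v; apply/lfunP=> f;
  rewrite !(add_lfunE, scale_lfunE, tensE).
  by rewrite linearP scalerDl /= -scalerA.
by rewrite scalerDr !scalerA mulrC.
Qed.
HB.instance Definition _ V W :=
  bilinear_isBilinear.Build K V W (tensor V W) *:%R *:%R (@tens V W)
    (@tens_bilinear V W).

Definition tens_lift_fun V W U (f : {bilinear V -> W -> U}) (t : tensor V W) : U :=
  \sum_(i < \dim {: V}) f (vbasis fullv)`_i (t (dual_basis (vbasis fullv) i)).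

Fact tens_lift_fun_linear V W U (f : {bilinear V -> W -> U}) :
  linear (tens_lift_fun f).
Proof.
move=> a s t; rewrite /tens_lift_fun scaler_sumr -big_split /=.
by apply: eq_bigr => i _; rewrite add_lfunE scale_lfunE linearPr.
Qed.
HB.instance Definition _ V W U (f : {bilinear V -> W -> U}) :=
  GRing.isLinear.Build _ _ _ _ _ (tens_lift_fun_linear f).

Definition tens_lift V W U (f : {bilinear V -> W -> U}) : 'Hom(tensor V W, U) :=
  linfun (tens_lift_fun f).

Lemma tens_liftE V W U (f : {bilinear V -> W -> U}) x y :
  tens_lift f (tens x y) = f x y.
Proof.
rewrite lfunE /= /tens_lift_fun.
rewrite [in RHS](coord_vbasis (memvf x)) linear_sumlz.
apply: eq_bigr => i _.
by rewrite tensE dual_basisE linearZr_LR linearZl_LR.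
Qed.

Lemma tensor_decomp V W (t : tensor V W) :
  t = \sum_(i < \dim {: V})
        tens (vbasis fullv)`_i (t (dual_basis (vbasis fullv) i)).
Proof.
apply/lfunP=> f; rewrite sum_lfunE.
under eq_bigr do rewrite tensE -linearZ.
rewrite -linear_sum; congr (t _); apply/lfunP=> x.
rewrite sum_lfunE [in LHS](coord_vbasis (memvf x)) linear_sum.
by apply: eq_bigr => i _; rewrite scale_lfunE dual_basisE linearZ /= [LHS]mulrC.
Qed.

Lemma tens_lift_uniq V W U (g h : 'Hom(tensor V W, U)) :
  (forall x y, g (tens x y) = h (tens x y)) -> g = h.
Proof.
move=> gh; apply/lfunP=> t; rewrite (tensor_decomp t) !linear_sum.
apply: eq_bigr => i _; exact: gh.
Qed.

Definition rtens V W (x : V) (y : W) : tensor W V := tens y x.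

Fact rtens_bilinear V W : bilinear_for *:%R *:%R (@rtens V W).
Proof. by split=> [y|x] a u v; rewrite /rtens ?linearPr ?linearPl. Qed.
HB.instance Definition _ V W :=
  bilinear_isBilinear.Build K V W (tensor W V) *:%R *:%R (@rtens V W)
    (@rtens_bilinear V W).

Definition flip V W : 'Hom(tensor V W, tensor W V) := tens_lift (@rtens V W).

Lemma flipE V W (x : V) (y : W) : flip V W (tens x y) = tens y x.
Proof. exact: tens_liftE. Qed.

Definition skew_symmetric V (r : tensor V V) : Prop := flip V V r = - r.

End Tensor.

Section AntiPreLie.
Variables (K : fieldType) (A : vectType K).

Definition commutator (m : A -> A -> A) (x y : A) : A := m x y - m y x.

Record antiPreLie := AntiPreLie {
  apl_mul :> {bilinear A -> A -> A};
  _ : forall x y z,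
    apl_mul x (apl_mul y z) - apl_mul y (apl_mul x z)
    = apl_mul (commutator apl_mul y x) z;
  _ : forall x y z,
    apl_mul (commutator apl_mul x y) z + apl_mul (commutator apl_mul y z) x
    + apl_mul (commutator apl_mul z x) y = 0
}.

Record preAPL := PreAPL {
  succ : {bilinear A -> A -> A};
  prec : {bilinear A -> A -> A};
  _ : forall x y z,
    succ (succ y x + prec y x) z - succ (succ x y + prec x y) z
    = succ x (succ y z) - succ y (succ x z);
  _ : forall x y z,
    prec z (succ x y + prec x y)
    = succ x (prec z y) + prec (succ x z) y - prec (prec z x) y;
  _ : forall x y z,
    succ (succ y x + prec y x) z - succ (succ x y + prec x y) z
    = prec (succ y z) x - prec (succ x z) y
      - prec (prec z y) x + prec (prec z x) y
}.

End AntiPreLie.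

Section Subadjacent.
Variables (K : fieldType) (A : vectType K) (P : preAPL A).

Definition subadj_mul (x y : A) : A := succ P x y + prec P x y.

Fact subadj_mul_bilinear : bilinear_for *:%R *:%R subadj_mul.
Proof.
split=> [y|x] a u v; rewrite /subadj_mul /=.
  by rewrite !linearPl /= scalerDr addrACA.
by rewrite !linearPr /= scalerDr addrACA.
Qed.
HB.instance Definition _ :=
  bilinear_isBilinear.Build K A A A *:%R *:%R subadj_mul subadj_mul_bilinear.

Fact subadj_apl1 x y z :
  subadj_mul x (subadj_mul y z) - subadj_mul y (subadj_mul x z)
  = subadj_mul (commutator subadj_mul y x) z.
Proof.
rewrite /commutator /subadj_mul; case: P => s p H1 H2 H3 /=.
apply: (lincomb (subE (H2 y z x) (addE (H1 x y z) (H2 x z y)))).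
rewrite !(linearDl s, linearDr s, linearNl s, linearDl p, linearDr p, linearNl p).
abgroup.
Qed.

Fact subadj_apl2 x y z :
  subadj_mul (commutator subadj_mul x y) z
  + subadj_mul (commutator subadj_mul y z) x
  + subadj_mul (commutator subadj_mul z x) y = 0.
Proof.
rewrite /commutator /subadj_mul; case: P => s p H1 H2 H3 /=.
apply: (lincomb (subE (erefl 0) (addE (H3 x y z) (addE (H3 y z x) (H3 z x y))))).
rewrite !(linearDl s, linearDr s, linearNl s, linearDl p, linearDr p, linearNl p).
abgroup.
Qed.

Definition subadjacent : antiPreLie A := AntiPreLie subadj_apl1 subadj_apl2.

End Subadjacent.

Section Representation.
Variables (K : fieldType) (A : vectType K).

Record representation (P : antiPreLie A) (V : vectType K) := Representation {
  repl : 'Hom(A, 'End(V));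
  repr : 'Hom(A, 'End(V));
  _ : forall x y,
    repl (P y x) - repl (P x y)
    = (repl x \o repl y)%VF - (repl y \o repl x)%VF;
  _ : forall x y,
    repr (P x y)
    = (repl x \o repr y)%VF + (repr y \o repl x)%VF - (repr y \o repr x)%VF;
  _ : forall x y,
    repl (P y x) - repl (P x y)
    = (repr x \o repl y)%VF - (repr y \o repl x)%VF
      - (repr x \o repr y)%VF + (repr y \o repr x)%VF
}.

End Representation.

Section PreAPLRepresentation.
Variables (K : fieldType) (A : vectType K) (P : preAPL A).

Definition Lsucc_fun (x : A) : 'End(A) := linfun (succ P x).
Definition Rprec_fun (x : A) : 'End(A) := linfun (applyr (prec P) x).

Fact Lsucc_linear : linear Lsucc_fun.
Proof.
by move=> a x y; apply/lfunP=> z; rewrite add_lfunE scale_lfunE !lfunE /= linearPl.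
Qed.
HB.instance Definition _ := GRing.isLinear.Build _ _ _ _ _ Lsucc_linear.

Fact Rprec_linear : linear Rprec_fun.
Proof.
by move=> a x y; apply/lfunP=> z; rewrite add_lfunE scale_lfunE !lfunE /= linearPr.
Qed.
HB.instance Definition _ := GRing.isLinear.Build _ _ _ _ _ Rprec_linear.

Definition Lsucc : 'Hom(A, 'End(A)) := linfun Lsucc_fun.
Definition Rprec : 'Hom(A, 'End(A)) := linfun Rprec_fun.

Lemma LsuccE x y : Lsucc x y = succ P x y.
Proof. by rewrite !lfunE. Qed.

Lemma RprecE x y : Rprec x y = prec P y x.
Proof. by rewrite !lfunE. Qed.

Fact LR_rep1 x y :
  Lsucc (subadjacent P y x) - Lsucc (subadjacent P x y)
  = (Lsucc x \o Lsucc y)%VF - (Lsucc y \o Lsucc x)%VF.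
Proof.
apply/lfunP=> v; rewrite !(add_lfunE, opp_lfunE, comp_lfunE, LsuccE, RprecE) /=.
by rewrite /subadj_mul; case: P.
Qed.

Fact LR_rep2 x y :
  Rprec (subadjacent P x y)
  = (Lsucc x \o Rprec y)%VF + (Rprec y \o Lsucc x)%VF - (Rprec y \o Rprec x)%VF.
Proof.
apply/lfunP=> v; rewrite !(add_lfunE, opp_lfunE, comp_lfunE, LsuccE, RprecE) /=.
by rewrite /subadj_mul; case: P.
Qed.

Fact LR_rep3 x y :
  Lsucc (subadjacent P y x) - Lsucc (subadjacent P x y)
  = (Rprec x \o Lsucc y)%VF - (Rprec y \o Lsucc x)%VF
    - (Rprec x \o Rprec y)%VF + (Rprec y \o Rprec x)%VF.
Proof.
apply/lfunP=> v; rewrite !(add_lfunE, opp_lfunE, comp_lfunE, LsuccE, RprecE) /=.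
by rewrite /subadj_mul; case: P.
Qed.

Definition preAPL_rep : representation (subadjacent P) A :=
  Representation LR_rep1 LR_rep2 LR_rep3.

End PreAPLRepresentation.

Section DualRepresentation.
Variables (K : fieldType) (A V : vectType K).

Section DualAction.
Variable rho : 'Hom(A, 'End(V)).

Definition dual_act_fun2 (x : A) (u : dual V) : dual V := - (u \o rho x)%VF.

Fact dual_act_fun2_linear x : linear (dual_act_fun2 x).
Proof.
move=> a u w; apply/lfunP=> v; rewrite /dual_act_fun2.
rewrite !(add_lfunE, opp_lfunE, scale_lfunE, comp_lfunE) /=.
by rewrite scalerN -opprD.
Qed.
HB.instance Definition _ x :=
  GRing.isLinear.Build _ _ _ _ _ (dual_act_fun2_linear x).

Definition dual_act_fun (x : A) : 'End(dual V) := linfun (dual_act_fun2 x).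

Fact dual_act_fun_linear : linear dual_act_fun.
Proof.
move=> a x y; apply/lfunP=> u; apply/lfunP=> v.
rewrite !(add_lfunE, scale_lfunE) !lfunE /= /dual_act_fun2.
rewrite !(add_lfunE, opp_lfunE, scale_lfunE, comp_lfunE) /=.
by rewrite linearP add_lfunE scale_lfunE linearP scalerN -opprD.
Qed.
HB.instance Definition _ :=
  GRing.isLinear.Build _ _ _ _ _ dual_act_fun_linear.

Definition dual_act : 'Hom(A, 'End(dual V)) := linfun dual_act_fun.

Lemma dual_actE x u v : dual_act x u v = - u (rho x v).
Proof. rewrite /dual_act lfunE /= /dual_act_fun lfunE /= /dual_act_fun2.
by rewrite opp_lfunE comp_lfunE. Qed.

End DualAction.

Variables (P : antiPreLie A) (R : representation P V).

Let L' : 'Hom(A, 'End(dual V)) := dual_act (repr R) - dual_act (repl R).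
Let R' : 'Hom(A, 'End(dual V)) := dual_act (repr R).

Let L'E x u v : L' x u v = - u (repr R x v) + u (repl R x v).
Proof. by rewrite !(add_lfunE, opp_lfunE) !dual_actE opprK. Qed.

Let R'E x u v : R' x u v = - u (repr R x v).
Proof. exact: dual_actE. Qed.

Let E1 x y (u : dual V) v :
  u (repl R (P y x) v) - u (repl R (P x y) v)
  = u (repl R x (repl R y v)) - u (repl R y (repl R x v)) :> K.
Proof.
case: R => l r H1 H2 H3 /=; have /(congr1 (fun f : 'End(V) => u (f v))) := H1 x y.
by rewrite !(add_lfunE, opp_lfunE, comp_lfunE) !linearB.
Qed.

Let E2 x y (u : dual V) v :
  u (repr R (P x y) v)
  = u (repl R x (repr R y v)) + u (repr R y (repl R x v))
    - u (repr R y (repr R x v)) :> K.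
Proof.
case: R => l r H1 H2 H3 /=; have /(congr1 (fun f : 'End(V) => u (f v))) := H2 x y.
by rewrite !(add_lfunE, opp_lfunE, comp_lfunE) linearB linearD.
Qed.

Let E3 x y (u : dual V) v :
  u (repl R (P y x) v) - u (repl R (P x y) v)
  = u (repr R x (repl R y v)) - u (repr R y (repl R x v))
    - u (repr R x (repr R y v)) + u (repr R y (repr R x v)) :> K.
Proof.
case: R => l r H1 H2 H3 /=; have /(congr1 (fun f : 'End(V) => u (f v))) := H3 x y.
by rewrite !(add_lfunE, opp_lfunE, comp_lfunE) !(linearD, linearN).
Qed.

Fact dual_rep1 x y :
  L' (P y x) - L' (P x y) = (L' x \o L' y)%VF - (L' y \o L' x)%VF.
Proof.
apply/lfunP=> u; apply/lfunP=> v.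
rewrite !(add_lfunE, opp_lfunE, comp_lfunE, L'E) !E2.
apply: (lincomb (addE (subE (E3 x y u v) (E1 x y u v)) (E3 x y u v))).
abgroup.
Qed.

Fact dual_rep2 x y :
  R' (P x y) = (L' x \o R' y)%VF + (R' y \o L' x)%VF - (R' y \o R' x)%VF.
Proof.
apply/lfunP=> u; apply/lfunP=> v.
rewrite !(add_lfunE, opp_lfunE, comp_lfunE, L'E, R'E) !E2.
abgroup.
Qed.

Fact dual_rep3 x y :
  L' (P y x) - L' (P x y)
  = (R' x \o L' y)%VF - (R' y \o L' x)%VF - (R' x \o R' y)%VF
    + (R' y \o R' x)%VF.
Proof.
apply/lfunP=> u; apply/lfunP=> v.
rewrite !(add_lfunE, opp_lfunE, comp_lfunE, L'E, R'E) !E2.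
apply: (lincomb (E3 x y u v)).
abgroup.
Qed.

Definition dual_rep : representation P (dual V) :=
  @Representation _ _ P (dual V)
    (dual_act (repr R) - dual_act (repl R)) (dual_act (repr R))
    dual_rep1 dual_rep2 dual_rep3.

End DualRepresentation.

Section Semidirect.
Variables (K : fieldType) (A V : vectType K).
Variables (P : antiPreLie A) (R : representation P V).

Definition semidirect_mul (a b : A * V) : A * V :=
  (P a.1 b.1, repl R a.1 b.2 + repr R b.1 a.2).

Fact semidirect_mul_bilinear : bilinear_for *:%R *:%R semidirect_mul.
Proof.
split=> [[y v]|[x u]] a [x1 u1] [x2 u2]; congr pair => /=.
- by rewrite linearPl.
- rewrite !linearP add_lfunE scale_lfunE /= scalerDr.
  abgroup.
- by rewrite linearPr.
- rewrite !linearP add_lfunE scale_lfunE /= scalerDr.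
  abgroup.
Qed.
HB.instance Definition _ :=
  bilinear_isBilinear.Build K (A * V)%type (A * V)%type (A * V)%type
    *:%R *:%R semidirect_mul semidirect_mul_bilinear.

Let E1 x y v :
  repl R (P y x) v - repl R (P x y) v
  = repl R x (repl R y v) - repl R y (repl R x v).
Proof.
case: R => l r H1 H2 H3 /=; have /(congr1 (fun f : 'End(V) => f v)) := H1 x y.
by rewrite !(add_lfunE, opp_lfunE, comp_lfunE).
Qed.

Let E2 x y v :
  repr R (P x y) v
  = repl R x (repr R y v) + repr R y (repl R x v) - repr R y (repr R x v).
Proof.
case: R => l r H1 H2 H3 /=; have /(congr1 (fun f : 'End(V) => f v)) := H2 x y.
by rewrite !(add_lfunE, opp_lfunE, comp_lfunE).
Qed.

Let E3 x y v :
  repl R (P y x) v - repl R (P x y) v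
  = repr R x (repl R y v) - repr R y (repl R x v)
    - repr R x (repr R y v) + repr R y (repr R x v).
Proof.
case: R => l r H1 H2 H3 /=; have /(congr1 (fun f : 'End(V) => f v)) := H3 x y.
by rewrite !(add_lfunE, opp_lfunE, comp_lfunE).
Qed.

Fact semidirect_apl1 a b c :
  semidirect_mul a (semidirect_mul b c) - semidirect_mul b (semidirect_mul a c)
  = semidirect_mul (commutator semidirect_mul b a) c.
Proof.
case: a b c => [x u] [y v] [z w]; congr pair => /=.
  by case: P => m H1 H2; exact: H1.
rewrite /commutator /semidirect_mul /= !(linearD, linearN) !(add_lfunE, opp_lfunE) !E2 ?(linearD, linearN).
apply: (lincomb (subE (erefl 0) (E1 x y w))).
abgroup.
Qed.

Fact semidirect_apl2 a b c :
  semidirect_mul (commutator semidirect_mul a b) c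
  + semidirect_mul (commutator semidirect_mul b c) a
  + semidirect_mul (commutator semidirect_mul c a) b = 0.
Proof.
case: a b c => [x u] [y v] [z w]; congr pair => /=.
  by case: P => m H1 H2; exact: H2.
rewrite /commutator /semidirect_mul /= !(linearD, linearN) !(add_lfunE, opp_lfunE).
apply: (lincomb (subE (erefl 0) (addE (E3 x y w) (addE (E3 y z u) (E3 z x v))))).
abgroup.
Qed.

Definition semidirect : antiPreLie (A * V)%type :=
  @AntiPreLie K (A * V)%type semidirect_mul semidirect_apl1 semidirect_apl2.

End Semidirect.

Lemma tens_sum_eq (K : fieldType) (V W U : vectType K) (f : V -> W -> U)
    n (a : 'I_n -> V) (b : 'I_n -> W) m (c : 'I_m -> V) (d : 'I_m -> W) :
  bilinear_for *:%R *:%R f ->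
  \sum_i tens (a i) (b i) = \sum_j tens (c j) (d j) ->
  \sum_i f (a i) (b i) = \sum_j f (c j) (d j).
Proof.
move=> f_bilin /(congr1 (tens_lift (HB.pack_for {bilinear V -> W -> U} f
  (bilinear_isBilinear.Build K V W U *:%R *:%R f f_bilin)))).
rewrite !linear_sum /=.
by under eq_bigr do rewrite tens_liftE; under [RHS]eq_bigr do rewrite tens_liftE.
Qed.

Section YangBaxter.
Variables (K : fieldType) (V : vectType K) (P : antiPreLie V).

Definition APL_YBE_term (x y z w : V) : tensor V (tensor V V) :=
  tens (P x z) (tens y w) + tens x (tens (P y z) w)
  - tens x (tens z (commutator P y w)).

Definition APL_YBE_expr n (a b : 'I_n -> V) : tensor V (tensor V V) :=
  \sum_(i < n) \sum_(j < n) APL_YBE_term (a i) (b i) (a j) (b j).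

(* The decomposition of r is immaterial, see APL_YBE_solutionP.               *)
Definition APL_YBE_solution (r : tensor V V) : Prop :=
  forall n (a b : 'I_n -> V),
    r = \sum_(i < n) tens (a i) (b i) -> APL_YBE_expr a b = 0.

Fact APL_YBE_term_bilinear1 z w :
  bilinear_for *:%R *:%R (fun x y => APL_YBE_term x y z w).
Proof.
split=> [y|x] k u v; rewrite /APL_YBE_term /commutator;
  rewrite ?(linearPl P, linearPr P); apply: scalar_inj => f;
  rewrite !(linearPl (@tens K V _), linearBr (@tens K V _),
            linearPr (@tens K V _), linearDr (@tens K V _),
            linearZr_LR (@tens K V _)) !(linearD f, linearN f, scalarZ f);
  rewrite ?(linearDl (@tens K V _), linearZl_LR (@tens K V _),
            linearDr (@tens K V _), linearZr_LR (@tens K V _));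
  rewrite ?(linearD f, linearN f, scalarZ f); ring.
Qed.

Fact APL_YBE_term_bilinear2 x y :
  bilinear_for *:%R *:%R (APL_YBE_term x y).
Proof.
split=> [w|z] k u v; rewrite /APL_YBE_term /commutator;
  rewrite ?(linearPl P, linearPr P); apply: scalar_inj => f;
  rewrite !(linearPl (@tens K V _), linearBr (@tens K V _),
            linearPr (@tens K V _), linearDr (@tens K V _),
            linearZr_LR (@tens K V _)) !(linearD f, linearN f, scalarZ f);
  rewrite ?(linearDl (@tens K V _), linearZl_LR (@tens K V _),
            linearDr (@tens K V _), linearZr_LR (@tens K V _));
  rewrite ?(linearD f, linearN f, scalarZ f); ring.
Qed.

Lemma APL_YBE_solutionP n (a b : 'I_n -> V) :
  APL_YBE_solution (\sum_(i < n) tens (a i) (b i)) <-> APL_YBE_expr a b = 0.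
Proof.
split=> [|ab0 m c d abcd]; first exact.
rewrite -ab0 /APL_YBE_expr; transitivity
  (\sum_(i < m) \sum_(j < n) APL_YBE_term (c i) (d i) (a j) (b j)).
  apply: eq_bigr => i _; apply: tens_sum_eq (esym abcd).
  exact: APL_YBE_term_bilinear2.
rewrite exchange_big [RHS]exchange_big /=.
apply: eq_bigr => j _.
exact: (tens_sum_eq (APL_YBE_term_bilinear1 (a j) (b j)) (esym abcd)).
Qed.

Lemma tens_sumP (r : tensor V V) :
  exists n (a b : 'I_n -> V), r = \sum_(i < n) tens (a i) (b i).
Proof. by do 3!eexists; exact: tensor_decomp. Qed.

End YangBaxter.

Lemma semidirect_preAPLE (K : fieldType) (A : vectType K) (P : preAPL A)
    (x y : A) (u v : dual A) :
  semidirect (dual_rep (preAPL_rep P)) (x, u) (y, v)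
  = (succ P x y + prec P x y,
     (dual_act (Rprec P) - dual_act (Lsucc P)) x v + dual_act (Rprec P) y u).
Proof. by []. Qed.

(* Main.v *)
(* Since [r] is the skew-symmetrization of the canonical element
   [\sum_i e_i (x) e_i^*], and the canonical element turns a transpose acting on
   its second leg into the original map acting on its first, every dual action
   in the Yang-Baxter expression can be moved back to [A].  The expression then
   splits according to which of its three legs lies in [A], and each part
   vanishes by [x o y = x > y + x < y] alone. *)

Require Import Defs.
From HB Require Import structures.
From mathcomp Require Import all_boot all_order all_algebra.

Set Implicit Arguments.
Unset Strict Implicit.
Unset Printing Implicit Defensive.

Import GRing.Theory.
Local Open Scope ring_scope.

(** * Dual bases and the canonical element *)

Section DualBasis.
Variables (K : fieldType) (A : vectType K) (n : nat) (e : n.-tuple A).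
Hypothesis eP : basis_of {: A}%VS e.

Lemma coord_tnth_sum (x : A) : x = \sum_i (dual_basis e i x : K) *: tnth e i.
Proof.
rewrite [LHS](coord_basis eP (memvf x)); apply: eq_bigr => i _.
by rewrite dual_basisE (tnth_nth 0).
Qed.

Lemma dual_basis_sum (u : dual A) :
  u = \sum_i (u (tnth e i) : K) *: dual_basis e i.
Proof.
apply/lfunP=> x; rewrite [in LHS](coord_tnth_sum x) sum_lfunE linear_sum.
by apply: eq_bigr => i _; rewrite scale_lfunE linearZ /= [LHS]mulrC.
Qed.

(* The canonical element of [A (x) A^*] intertwines an endomorphism with its
   transpose. *)
Lemma tens_transpose (T : 'End(A)) :
  \sum_i tens (tnth e i) (dual_basis e i \o T)%VF
  = \sum_i tens (T (tnth e i)) (dual_basis e i).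
Proof.
(* Both sides expand into the matrix entries of [T] in the basis [e]; exchanging the two sums
   matches them. *)
under eq_bigr => i _ do
  rewrite (dual_basis_sum (dual_basis e i \o T)%VF) linear_sumr.
under [RHS]eq_bigr => i _ do
  rewrite (coord_tnth_sum (T (tnth e i))) linear_sumlz.
rewrite [LHS]exchange_big; apply: eq_bigr => i _; apply: eq_bigr => j _ /=.
by rewrite comp_lfunE linearZr_LR linearZl_LR.
Qed.

(** A bilinear [F] factors through the tensor product, so [T] can be moved across wherever the two
    legs of the canonical element are placed. *)
Lemma bilinear_transpose (U : vectType K) (F : A -> dual A -> U) (T : 'End(A)) :
  bilinear_for *:%R *:%R F ->
  \sum_i F (tnth e i) (dual_basis e i \o T)%VF
  = \sum_i F (T (tnth e i)) (dual_basis e i).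
Proof. by move=> F_bilin; apply: tens_sum_eq F_bilin (tens_transpose T). Qed.

End DualBasis.

(** Meant for the [n + n] pure tensors of the skew-symmetrized element: one block for each pair of
    halves. *)
Lemma sum_split_ord2 (V : zmodType) n (f : 'I_(n + n) -> 'I_(n + n) -> V) :
  \sum_k \sum_l f k l
  = \sum_i \sum_j f (lshift n i) (lshift n j)
    + \sum_i \sum_j f (lshift n i) (rshift n j)
    + (\sum_i \sum_j f (rshift n i) (lshift n j)
       + \sum_i \sum_j f (rshift n i) (rshift n j)).
Proof.
by rewrite big_split_ord; congr (_ + _); rewrite -big_split;
  apply: eq_bigr => i _; rewrite big_split_ord.
Qed.

(** Takes a bare [linear] hypothesis, as extracted from the [bilinear_for] facts about
    [APL_YBE_term]. *)
Lemma linear_opp (K : fieldType) (V W : vectType K) (f : V -> W) :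
  linear f -> {morph f : x / - x}.
Proof.
move=> f_lin x; have f0 : f 0 = 0.
  by have := f_lin (-1) 0 0; rewrite scaler0 addr0 scaleN1r addNr.
by have := f_lin (-1) x 0; rewrite f0 !addr0 !scaleN1r.
Qed.

Lemma tensPl (K : fieldType) (V W : vectType K) (y : W) : linear (@tens K V W ^~ y).
Proof. by move=> a x x'; rewrite linearPl. Qed.

Lemma tensPr (K : fieldType) (V W : vectType K) (x : V) : linear (@tens K V W x).
Proof. by move=> a y y'; rewrite linearPr. Qed.

Section PairInjections.
Variables (K : fieldType) (V W : vectType K).

Definition inl_pair (x : V) : V * W := (x, 0).
Definition inr_pair (y : W) : V * W := (0, y).

Fact inl_pair_linear : linear inl_pair.
Proof. by move=> a x y; congr pair; rewrite /= scaler0 addr0. Qed.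
HB.instance Definition _ := GRing.isLinear.Build _ _ _ _ _ inl_pair_linear.

Fact inr_pair_linear : linear inr_pair.
Proof. by move=> a x y; congr pair; rewrite /= scaler0 addr0. Qed.
HB.instance Definition _ := GRing.isLinear.Build _ _ _ _ _ inr_pair_linear.

End PairInjections.

(** Puts the dual action in the composite form to which transposition applies. *)
Lemma dual_act_comp (K : fieldType) (A V : vectType K)
    (rho : 'Hom(A, 'End(V))) (x : A) (u : dual V) :
  dual_act rho x u = - (u \o rho x)%VF.
Proof. by apply/lfunP=> v; rewrite dual_actE opp_lfunE comp_lfunE. Qed.

(** * Products in the semi-direct product *)

Section CanonicalSolution.
Variables (K : fieldType) (A : vectType K) (P : preAPL A).

Let S := semidirect (dual_rep (preAPL_rep P)).
Local Notation io := (@inl_pair K A (dual A)).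
Local Notation ka := (@inr_pair K A (dual A)).

(* The letters [l] and [r] name the summands [A] and [A^*], [w] an arbitrary
   tensor factor. *)
Lemma semidirect_ll x y : S (io x) (io y) = io (succ P x y + prec P x y).
Proof. by rewrite semidirect_preAPLE !linear0 addr0. Qed.

(** The sign in the definition of the dual action reverses the difference of the two dual maps. *)
Lemma semidirect_lr x u :
  S (io x) (ka u) = ka (u \o Lsucc P x)%VF - ka (u \o Rprec P x)%VF.
Proof.
rewrite -linearB /= semidirect_preAPLE !(add_lfunE, opp_lfunE) !dual_act_comp.
by rewrite opprK !linear0 comp_lfun0l oppr0 !addr0 addrC.
Qed.

Lemma semidirect_rl u x : S (ka u) (io x) = - ka (u \o Rprec P x)%VF.
Proof.
rewrite -linearN /= semidirect_preAPLE !linear0l dual_act_comp linear0.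
by rewrite !add0r.
Qed.

Lemma semidirect_rr u v : S (ka u) (ka v) = 0.
Proof. by rewrite semidirect_preAPLE !linear0 !zero_lfunE !addr0. Qed.

Variables (n : nat) (e : n.-tuple A).
Hypothesis eP : basis_of {: A}%VS e.
Local Notation E i := (io (tnth e i)).
Local Notation D i := (ka (dual_basis e i)).
Local Notation tens3 x y z := (tens x (tens y z)).

(** * Transposition in the six placements of the canonical element among three legs *)

Section Transpose.
Variables (T : 'End(A)) (w : A * dual A).

Local Ltac transpose F :=
  apply: (bilinear_transpose eP (F := F)); split=> [?|?] ? ? ? /=;
  by rewrite ?(inl_pair_linear, inr_pair_linear) !(tensPl, tensPr).

Lemma transpose_lrw :
  \sum_i tens3 (E i) (ka (dual_basis e i \o T)%VF) w
  = \sum_i tens3 (io (T (tnth e i))) (D i) w.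
Proof. transpose (fun x u => tens3 (io x) (ka u) w). Qed.

Lemma transpose_rlw :
  \sum_i tens3 (ka (dual_basis e i \o T)%VF) (E i) w
  = \sum_i tens3 (D i) (io (T (tnth e i))) w.
Proof. transpose (fun x u => tens3 (ka u) (io x) w). Qed.

Lemma transpose_lwr :
  \sum_i tens3 (E i) w (ka (dual_basis e i \o T)%VF)
  = \sum_i tens3 (io (T (tnth e i))) w (D i).
Proof. transpose (fun x u => tens3 (io x) w (ka u)). Qed.

Lemma transpose_rwl :
  \sum_i tens3 (ka (dual_basis e i \o T)%VF) w (E i)
  = \sum_i tens3 (D i) w (io (T (tnth e i))).
Proof. transpose (fun x u => tens3 (ka u) w (io x)). Qed.

Lemma transpose_wlr :
  \sum_i tens3 w (E i) (ka (dual_basis e i \o T)%VF)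
  = \sum_i tens3 w (io (T (tnth e i))) (D i).
Proof. transpose (fun x u => tens3 w (io x) (ka u)). Qed.

Lemma transpose_wrl :
  \sum_i tens3 w (ka (dual_basis e i \o T)%VF) (E i)
  = \sum_i tens3 w (D i) (io (T (tnth e i))).
Proof. transpose (fun x u => tens3 w (ka u) (io x)). Qed.

End Transpose.

(** * The four blocks of the Yang-Baxter expression *)

Lemma YBE_block_lrlr :
  \sum_i \sum_j APL_YBE_term S (E i) (D i) (E j) (D j)
  = \sum_i \sum_j tens3 (io (succ P (tnth e i) (tnth e j))) (D i) (D j).
Proof.
(* With [j] fixed, [Rprec P (tnth e j)] is a single endomorphism, transposed over [i]; it removes
   the [prec] part of the product. *)
rewrite exchange_big [RHS]exchange_big; apply: eq_bigr => j _ /=.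
under eq_bigr => i _.
  rewrite /APL_YBE_term /commutator semidirect_ll semidirect_rl !semidirect_rr.
  rewrite subrr !linear0r subr0 linearNl linearNr.
  over.
rewrite sumrB [X in _ - X]transpose_lrw -sumrB; apply: eq_bigr => i _.
by rewrite -linearBl -linearB /= RprecE addrK.
Qed.

(** The commutator gives the tensors with first leg in [A], the product [S (E i) (D j)] those with
    third leg in [A]. *)
Lemma YBE_block_lrrl :
  \sum_i \sum_j APL_YBE_term S (E i) (D i) (D j) (E j)
  = \sum_i \sum_j tens3 (io (succ P (tnth e i) (tnth e j))) (D i) (D j)
    + \sum_i \sum_j tens3 (D i) (D j)
        (io (succ P (tnth e j) (tnth e i) - prec P (tnth e i) (tnth e j))).
Proof.
transitivity (\sum_i \sum_j (tens3 (S (E i) (D j)) (D i) (E j)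
    + tens3 (E i) (D j) (ka (dual_basis e i \o Lsucc P (tnth e j))%VF))).
  apply: eq_bigr => i _; apply: eq_bigr => j _.
  rewrite /APL_YBE_term /commutator semidirect_rr semidirect_rl (semidirect_lr (tnth e j)).
  rewrite linear0l linear0r addr0; congr (_ + _).
  (* The [Rprec] terms of the commutator of [D i] and [E j] cancel, leaving only [Lsucc]. *)
  by rewrite opprB addKr !linearNr opprK.
under eq_bigr do rewrite big_split.
rewrite big_split [LHS]addrC /=.
apply: addE.
  rewrite exchange_big /=; under eq_bigr do rewrite transpose_lwr.
  apply: eq_bigr => j _.
  by apply: eq_bigr => i _; rewrite LsuccE.
rewrite [RHS]exchange_big; apply: eq_bigr => i _ /=.
under eq_bigr => j _ do rewrite semidirect_lr linearBl /=.
rewrite sumrB [X in X - _]transpose_rwl [X in _ - X]transpose_rwl -sumrB.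
apply: eq_bigr => j _.
by rewrite -linearBr -linearBr -linearB LsuccE RprecE.
Qed.

(** All tensors acquire their middle leg in [A]: the two transposed terms subtract exactly the
    [prec] and [succ] parts of the product of [E i] and [E j]. *)
Lemma YBE_block_rllr :
  \sum_i \sum_j APL_YBE_term S (D i) (E i) (E j) (D j) = 0.
Proof.
transitivity (\sum_i \sum_j
   (- tens3 (ka (dual_basis e i \o Rprec P (tnth e j))%VF) (E i) (D j)
    + tens3 (D i)
        (io (succ P (tnth e i) (tnth e j) + prec P (tnth e i) (tnth e j))) (D j)
    - tens3 (D i) (E j) (ka (dual_basis e j \o Lsucc P (tnth e i))%VF))).
  apply: eq_bigr => i _; apply: eq_bigr => j _.
  rewrite /APL_YBE_term /commutator semidirect_ll !semidirect_rl semidirect_lr.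
  by rewrite opprK subrK linearNl.
under eq_bigr do rewrite sumrB [X in _ - X]transpose_wlr big_split.
rewrite sumrB big_split /=.
rewrite exchange_big /=; under eq_bigr do rewrite sumrN transpose_rlw -sumrN.
rewrite exchange_big -big_split -sumrB big1 //= => i _.
rewrite -big_split -sumrB big1 //= => j _.
by rewrite LsuccE RprecE linearD linearDl linearDr addrCA addNr addr0 subrr.
Qed.

Lemma YBE_block_rlrl :
  \sum_i \sum_j APL_YBE_term S (D i) (E i) (D j) (E j)
  = \sum_i \sum_j tens3 (D i) (D j)
      (io (succ P (tnth e j) (tnth e i) - prec P (tnth e i) (tnth e j))).
Proof.
apply: eq_bigr => i _.
transitivity (\sum_j
   (tens3 (D i) (ka (dual_basis e j \o Lsucc P (tnth e i))%VF) (E j)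
    - tens3 (D i) (ka (dual_basis e j \o Rprec P (tnth e i))%VF) (E j)
    - tens3 (D i) (D j) (S (E i) (E j) - S (E j) (E i)))).
  apply: eq_bigr => j _.
  rewrite /APL_YBE_term /commutator semidirect_rr semidirect_lr.
  by rewrite linear0l add0r linearBl linearBr.
rewrite !sumrB [X in X - _ - _]transpose_wrl [X in _ - X - _]transpose_wrl.
rewrite -!sumrB; apply: eq_bigr => j _.
rewrite -!linearBr !semidirect_ll -!linearB LsuccE RprecE /=.
(* Expanding the commutator cancels [succ P (tnth e i) (tnth e j)] and
   [prec P (tnth e j) (tnth e i)]. *)
do 3!congr (_ _); rewrite opprB addrC -addrA opprD.
rewrite [X in _ + X]addrACA addNr add0r.
by rewrite addrACA subrr addr0.
Qed.

End CanonicalSolution.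

(** * Assembly of the blocks *)

Theorem proposition2p32 (K : closedFieldType) (charK : [pchar K] =i pred0)
    (A : vectType K) (P : preAPL A) (n : nat) (e : n.-tuple A)
    (eP : basis_of {: A}%VS e) :
  let S : antiPreLie (A * dual A)%type := semidirect (dual_rep (preAPL_rep P)) in
  let r : tensor (A * dual A)%type (A * dual A)%type :=
    \sum_(i < n) (tens (tnth e i, 0) (0, dual_basis e i)
                  - tens (0, dual_basis e i) (tnth e i, 0)) in
  skew_symmetric r /\ APL_YBE_solution S r.
Proof.
move=> S r; split.
  rewrite /skew_symmetric linear_sum -sumrN; apply: eq_bigr => i _.
  by rewrite linearB /= !flipE opprB.
pose E i := inl_pair (dual A) (tnth e i).
pose D i := inr_pair A (dual_basis e i).
(* The sign is carried by the first factor, so it meets only the first and third arguments of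
   [APL_YBE_term]. *)
pose a (k : 'I_(n + n)) := match split k with inl i => E i | inr i => - D i end.
pose b (k : 'I_(n + n)) := match split k with inl i => D i | inr i => E i end.
have al i : a (lshift n i) = E i by rewrite /a (unsplitK (inl i)).
have ar i : a (rshift n i) = - D i by rewrite /a (unsplitK (inr i)).
have bl i : b (lshift n i) = D i by rewrite /b (unsplitK (inl i)).
have br i : b (rshift n i) = E i by rewrite /b (unsplitK (inr i)).
clearbody a b.
have -> : r = \sum_k tens (a k) (b k).
  rewrite /r big_split_ord big_split; congr (_ + _); apply: eq_bigr => i _ /=.
    by rewrite al bl.
  by rewrite ar br linearNl.
apply/APL_YBE_solutionP.
have termNl x y z w : APL_YBE_term S (- x) y z w = - APL_YBE_term S x y z w.
  have [lin _] := APL_YBE_term_bilinear1 S z w.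
  exact: linear_opp (lin y) x.
have termNr x y z w : APL_YBE_term S x y (- z) w = - APL_YBE_term S x y z w.
  have [lin _] := APL_YBE_term_bilinear2 S x y.
  exact: linear_opp (lin w) z.
transitivity (\sum_i \sum_j APL_YBE_term S (E i) (D i) (E j) (D j)
  + - \sum_i \sum_j APL_YBE_term S (E i) (D i) (D j) (E j)
  + (- \sum_i \sum_j APL_YBE_term S (D i) (E i) (E j) (D j)
     + \sum_i \sum_j APL_YBE_term S (D i) (E i) (D j) (E j))).
  rewrite /APL_YBE_expr.
  rewrite (sum_split_ord2 (fun k l => APL_YBE_term S (a k) (b k) (a l) (b l))).
  apply: addE; apply: addE.
  - by apply: eq_bigr => i _; apply: eq_bigr => j _; rewrite !al !bl.
  - rewrite -sumrN; apply: eq_bigr => i _; rewrite -sumrN.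
    by apply: eq_bigr => j _; rewrite al bl ar br termNr.
  - rewrite -sumrN; apply: eq_bigr => i _; rewrite -sumrN.
    by apply: eq_bigr => j _; rewrite ar br al bl termNl.
  - apply: eq_bigr => i _; apply: eq_bigr => j _.
    by rewrite !ar !br termNl termNr opprK.
(* Here [x] collects the tensors with first leg in [A], [z] those with third leg in [A]; the [0] is
   the middle-leg block. *)
have cancel (V : zmodType) (x z : V) : x - (x + z) + (- 0 + z) = 0.
  by rewrite oppr0 add0r opprD addNKr addNr.
apply: etrans (cancel _ _ _).
exact: addE (addE (YBE_block_lrlr P eP) (congr1 -%R (YBE_block_lrrl P eP)))
  (addE (congr1 -%R (YBE_block_rllr P eP)) (YBE_block_rlrl P eP)).
Qed.
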